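(* Let $h\in\mathbb R\setminus\{0\}$ and let $\{g_n^{(h)}(y)\}_{n\in\mathbb N_0}$ be the deformed Mittag--Leffler polynomials. They satisfy the three-term recurrence relation $$(n+1)\,g_{n+1}^{(h)}(y)-2y\,g_n^{(h)}(y)-h^2(n-1)\,g_{n-1}^{(h)}(y)=0\qquad (n\ge 2),$$ with $$g_0^{(h)}(y)=1,\qquad g_1^{(h)}(y)=2y .$$
   Context: For $h\in\mathbb R\setminus\{0\}$, the deformed exponential function is $e_h(x,y)=(1+hx)^{y/h}$, where $y\in\mathbb R$; thus $e_{-h}(x,y)=(1-hx)^{-y/h}$. The deformed Mittag--Leffler polynomials $g_n^{(h)}(y)$, $n\in\mathbb N_0=\{0,1,2,\dots\}$, are defined as the coefficients in the expansion $$G_h(x,y)=e_h(x,y)\,e_{-h}(x,y)=(1+hx)^{y/h}(1-hx)^{-y/h}=\sum_{n=0}^\infty g_n^{(h)}(y)\,x^n\qquad(|hx|<1).$$ Each $g_n^{(h)}(y)$ is a polynomial in $y$. *)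

(* Defs.v *)
From Stdlib Require Import Reals.
From Coquelicot Require Import Coquelicot.
Open Scope R_scope.

Definition deformed_exp (h x y : R) : R := Rpower (1 + h * x) (y / h).

Definition G (h x y : R) : R := deformed_exp h x y * deformed_exp (- h) x y.

(** The expansion is required only for [|h x| < 1], where both bases
    [1 + h x] and [1 - h x] are positive, so that [Rpower] is the genuine real
    power.  Since this is a neighbourhood of [0], it determines [g] uniquely. *)
Definition deformed_Mittag_Leffler (h : R) (g : nat -> R -> R) : Prop :=
  forall x y : R, Rabs (h * x) < 1 -> is_pseries (fun n => g n y) x (G h x y).

(* Main.v *)
(** For fixed [y] the generating function satisfies the differential equation
    [(1 - h^2 x^2) G' = 2 y G] on [|h x| < 1], with [G(0) = 1].  Differentiating
    the series termwise and comparing the coefficients of [x^n] gives the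
    recurrence. *)

Require Import Defs.
From Stdlib Require Import Reals Lra Lia.
From Coquelicot Require Import Coquelicot.
Open Scope R_scope.

(** If the radius were some [c < r], the midpoint of [c] and [r] would lie outside the disk of
    convergence, yet convergence there forces the terms to tend to 0. *)
Lemma CV_radius_ge (a : nat -> R) (r : R) :
  (forall x : R, Rabs x < r -> ex_pseries a x) -> Rbar_le r (CV_radius a).
Proof.
  intros Ha.
  apply Rbar_not_lt_le; intros Hlt.
  pose proof (CV_radius_ge_0 a) as H0.
  destruct (CV_radius a) as [c| |] eqn:Hc; simpl in Hlt, H0; try easy.
  assert (Habs : Rabs ((c + r) / 2) = (c + r) / 2) by (apply Rabs_pos_eq; lra).
  apply (CV_disk_outside a ((c + r) / 2)).
  - rewrite Hc, Habs; simpl; lra.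
  - destruct (Ha ((c + r) / 2)) as [l Hl]; [lra|].
    apply ex_series_lim_0; exists l.
    now apply is_pseries_R.
Qed.

Lemma is_pseries_coef_unique (a b : nat -> R) (f : R -> R) (r : R) :
  0 < r ->
  (forall x : R, Rabs x < r -> is_pseries a x (f x)) ->
  (forall x : R, Rabs x < r -> is_pseries b x (f x)) ->
  forall n : nat, a n = b n.
Proof.
  intros Hr Ha Hb n.
  apply PSeries_ext_recip.
  - apply Rbar_lt_le_trans with r; [exact Hr|].
    apply CV_radius_ge; intros x Hx; eexists; now apply Ha.
  - apply Rbar_lt_le_trans with r; [exact Hr|].
    apply CV_radius_ge; intros x Hx; eexists; now apply Hb.
  - exists (mkposreal r Hr); intros x Hx.
    assert (Hx' : Rabs x < r).
    { replace x with (x - 0) by ring; exact Hx. }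
    rewrite (is_pseries_unique _ _ _ (Ha x Hx')).
    now rewrite (is_pseries_unique _ _ _ (Hb x Hx')).
Qed.

(** On the ball of radius [r - Rabs x] around [x], [f] agrees with [PSeries a], which may be
    differentiated termwise; uniqueness of the derivative then identifies [l]. A closed form of the
    derivative thus becomes the sum of the differentiated series. *)
Lemma is_pseries_derive (a : nat -> R) (f : R -> R) (r : R) :
  (forall x : R, Rabs x < r -> is_pseries a x (f x)) ->
  forall x l : R, Rabs x < r -> is_derive f x l -> is_pseries (PS_derive a) x l.
Proof.
  intros Ha x l Hx Hf.
  assert (Hrad : Rbar_lt (Rabs x) (CV_radius a)).
  { apply Rbar_lt_le_trans with r; [exact Hx|].
    apply CV_radius_ge; intros t Ht; eexists; now apply Ha. }
  assert (Hloc : locally x (fun t => f t = PSeries a t)).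
  { assert (Hd : 0 < r - Rabs x) by lra.
    exists (mkposreal _ Hd); intros t Ht.
    symmetry; apply is_pseries_unique, Ha.
    change (Rabs (t - x) < r - Rabs x) in Ht.
    pose proof (Rabs_triang (t - x) x) as Htri.
    replace (t - x + x) with t in Htri by (simpl in *; lra).
    lra. }
  replace l with (PSeries (PS_derive a) x).
  - now apply PSeries_correct, ex_pseries_derive.
  - rewrite <- (is_derive_unique _ _ _ (is_derive_PSeries a x Hrad)).
    apply is_derive_unique.
    exact (is_derive_ext_loc _ _ _ _ Hloc Hf).
Qed.

(** The logarithmic derivative of [G] in [x] is [y / (1 + h x) + y / (1 - h x)]. *)
Lemma is_derive_G (h x y : R) :
  h <> 0 -> Rabs (h * x) < 1 ->
  is_derive (fun t => G h t y) x (2 * y / (1 - (h * x) ^ 2) * G h x y).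
Proof.
  intros Hh Hx.
  apply Rabs_lt_between in Hx.
  unfold G, deformed_exp, Rpower.
  auto_derive.
  - repeat split; lra.
  - field; repeat split; nra.
Qed.

Lemma G_0 (h y : R) : G h 0 y = 1.
Proof.
  unfold G, deformed_exp, Rpower.
  rewrite !Rmult_0_r, Rplus_0_r, ln_1, !Rmult_0_r, exp_0.
  ring.
Qed.

(** Each [PS_incr_1] multiplies a series by [x], so the left side is the coefficient of [x^n] in
    [(1 - h^2 x^2) G']. The shifts insert zeros at the indices 0 and 1, so one formula covers every
    [n]. *)
Lemma generating_coef_equation (h : R) (g : nat -> R -> R) (y : R) :
  h <> 0 -> deformed_Mittag_Leffler h g ->
  forall n : nat,
    PS_derive (fun k => g k y) n
    - h ^ 2 * PS_incr_1 (PS_incr_1 (PS_derive (fun k => g k y))) n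
    = 2 * y * g n y.
Proof.
  intros Hh Hg.
  set (a := fun k => g k y).
  assert (Hpos : 0 < Rabs h) by now apply Rabs_pos_lt.
  assert (Hdisk : forall x, Rabs x < / Rabs h -> Rabs (h * x) < 1).
  { intros x Hx.
    rewrite Rabs_mult, <- (Rinv_r (Rabs h)) by lra.
    now apply Rmult_lt_compat_l. }
  assert (Ha : forall x, Rabs x < / Rabs h -> is_pseries a x (G h x y)).
  { intros x Hx; now apply Hg, Hdisk. }
  apply (is_pseries_coef_unique
           (PS_minus (PS_derive a)
              (PS_scal (h ^ 2) (PS_incr_1 (PS_incr_1 (PS_derive a)))))
           (PS_scal (2 * y) a) (fun x => 2 * y * G h x y) (/ Rabs h)).
  - now apply Rinv_0_lt_compat.
  - intros x Hx.
    pose proof (Hdisk x Hx) as Hhx.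
    pose proof (is_pseries_derive a _ _ Ha x _ Hx (is_derive_G h x y Hh Hhx))
      as Hd.
    pose proof (is_pseries_incr_1 _ _ _ (is_pseries_incr_1 _ _ _ Hd)) as Hi.
    pose proof (is_pseries_minus _ _ _ _ _ Hd
                  (is_pseries_scal (h ^ 2) _ _ _ (Rmult_comm _ _) Hi)) as Hm.
    (* Only the value of the sum remains to be matched: the factor [1 - (h x)^2] cancels the
       denominator of the derivative, which is nonzero on the disk. *)
    eapply eq_ind; [exact Hm|].
    unfold plus, opp, scal; simpl; unfold mult; simpl.
    apply Rabs_lt_between in Hhx.
    field; nra.
  - intros x Hx.
    apply (is_pseries_scal (2 * y) a x (G h x y) (Rmult_comm _ _)).
    now apply Ha.
Qed.

Theorem theorem2p1 (h : R) (g : nat -> R -> R) (hh : h <> 0)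
    (hg : deformed_Mittag_Leffler h g) :
  (forall (n : nat) (y : R), (2 <= n)%nat ->
     INR (n + 1) * g (n + 1)%nat y - 2 * y * g n y
       - h ^ 2 * (INR n - 1) * g (n - 1)%nat y = 0)
  /\ (forall y : R, g 0%nat y = 1)
  /\ (forall y : R, g 1%nat y = 2 * y).
Proof.
  assert (Hg0 : forall y, g 0%nat y = 1).
  (* At [x = 0] the series reduces to its constant term. *)
  { intros y.
    rewrite <- (G_0 h y), <- (PSeries_0 (fun k => g k y)).
    apply is_pseries_unique, hg.
    rewrite Rmult_0_r, Rabs_R0; lra. }
  split; [|split; [exact Hg0|]].
  (* With [n = m + 2] the double shift reads [PS_derive] at [m], that is
     [(m + 1) g_(m+1) = (n - 1) g_(n-1)]. *)
  - intros [|[|m]] y Hn; [lia|lia|].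
    pose proof (generating_coef_equation h g y hh hg (S (S m))) as H.
    unfold PS_derive, PS_incr_1 in H.
    replace (S (S m) + 1)%nat with (S (S (S m))) by lia.
    replace (S (S m) - 1)%nat with (S m) by lia.
    replace (INR (S (S m)) - 1) with (INR (S m)) by (rewrite (S_INR (S m)); ring).
    lra.
  - intros y.
    (* At index 0 the shifted term is zero, leaving [g_1 = 2 y g_0]. *)
    pose proof (generating_coef_equation h g y hh hg 0) as H.
    unfold PS_derive, PS_incr_1, zero in H; simpl in H.
    rewrite Hg0 in H.
    lra.
Qed.
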